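(* Let $(\mathbb{X}, \|\cdot\|)$ be a finite dimensional real normed linear space of dimension at least $2$. Then $\mu(\mathbb{X}) = 3$ if and only if there exist two points $u, v \in S_{\mathbb{X}}$ such that $\|tu+(1-t)v\| = 1$ for all $t \in (0,1)$ and $\|u-v\| = 2$.
   Context: $S_{\mathbb{X}} = \{x \in \mathbb{X} : \|x\| = 1\}$ is the unit sphere of $\mathbb{X}$. For $x,y \in \mathbb{X}$, $x$ is Birkhoff-James orthogonal to $y$, written $x \perp_B y$, if $\|x\| \leq \|x+\lambda y\|$ for all $\lambda \in \mathbb{R}$. For a real normed linear space $\mathbb{X}$ of dimension at least $2$, the rectangular constant is $$\mu(\mathbb{X}) = \sup\left\{ \frac{\|x\|+\|y\|}{\|x+y\|} : x, y \in \mathbb{X}\setminus\{0\},\ x \perp_B y \right\}.$$ *)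

(* Defs.v *)
From HB Require Import structures.
From mathcomp Require Import all_boot all_order all_algebra.
From mathcomp Require Import all_classical all_reals all_analysis.

Set Implicit Arguments.
Unset Strict Implicit.
Unset Printing Implicit Defensive.

Import Order.TTheory GRing.Theory Num.Theory.
Import numFieldNormedType.Exports.

Local Open Scope classical_set_scope.
Local Open Scope ring_scope.

#[short(type="finDimNormedModType")]
HB.structure Definition FinDimNormedModule (K : numFieldType) :=
  {X of NormedModule K X & Vector K X}.

Definition unit_sphere (R : realType) (X : normedModType R) : set X :=
  [set x | `|x| = 1].

Definition BJ_orthogonal (R : realType) (X : normedModType R) (x y : X) : Prop :=
  forall lambda : R, `|x| <= `|x + lambda *: y|.

(* The denominator never vanishes: x _|_B y gives |x + y| >= |x| > 0.  The
   supremum is taken in \bar R, where it exists without a boundedness proof. *)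
Definition rectangular_constant (R : realType) (X : normedModType R) : \bar R :=
  ereal_sup [set r : \bar R | exists x y : X,
    [/\ x <> 0, y <> 0, BJ_orthogonal x y
      & r = ((`|x| + `|y|) / `|x + y|)%:E]].

(* Main.v *)
Require Import Defs.
From mathcomp Require Import all_boot all_order all_algebra.
From mathcomp Require Import all_classical all_reals all_analysis.
From mathcomp Require Import lra.

Set Implicit Arguments.
Unset Strict Implicit.
Unset Printing Implicit Defensive.

Import Order.TTheory GRing.Theory Num.Theory.
Import numFieldNormedType.Exports.

Local Open Scope classical_set_scope.
Local Open Scope ring_scope.

(* Let x _|_B y. From |y| <= |x + y| + |x| and |x| <= |x + y| the ratio
   (|x| + |y|) / |x + y| is at most 3, with equality iff |x| = |x + y| and
   |y| = 2 |x|. Any ratio above 2 is realised with |x| = 1 and |y| <= 3, a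
   compact family in finite dimension, so a supremum of 3 is attained; then
   u = x and v = x + y span the segment. Conversely x = u and y = v - u give the
   ratio 3. *)

Lemma linear_rV_continuous (R : realType) (X : normedModType R) n
    (f : {linear 'rV[R]_n -> X}) : continuous f.
Proof.
have -> : (f : 'rV[R]_n -> X)
    = fun a => \sum_(j < n) a ord0 j *: f (delta_mx 0 j).
  apply/funext => a; rewrite {1}[a]row_sum_delta linear_sum.
  by apply: eq_bigr => j _; rewrite linearZ.
move=> a; have Fa := nbhs_filter a.
apply: cvg_big => [|j _]; first exact: add_continuous.
by apply: cvgZr_tmp; exact: coord_continuous.
Qed.

Import VectorInternalTheory.

Lemma r2v_continuous (R : realType) (X : finDimNormedModType R) :
  continuous (r2v : 'rV[R]_(dim X) -> X).
Proof. exact: linear_rV_continuous. Qed.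

Lemma continuous_norm_comp (R : realType) (T : topologicalType)
    (X : normedModType R) (f : T -> X) :
  continuous f -> continuous (fun t => `|f t|).
Proof. by move=> cf t; apply: cvg_norm; exact: cf. Qed.

(** One half of the equivalence of norms: on the compact coordinate sphere [|r2v a|] attains its
    minimum, which is positive because [r2v] is injective. Homogeneity extends the bound to all
    [a]. *)
Lemma norm_r2v_lower (R : realType) (X : finDimNormedModType R) :
  exists2 c : R, 0 < c & forall a : 'rV[R]_(dim X), c * `|a| <= `|r2v a : X|.
Proof.
pose S := [set a : 'rV[R]_(dim X) | `|a| = 1].
have nc : continuous (fun a : 'rV[R]_(dim X) => `|r2v a : X|).
  exact: continuous_norm_comp (@r2v_continuous R X).
have cS : compact S.
  apply: bounded_closed_compact.
    by exists 1; split=> // M M1 a /= ->; exact: ltW.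
  apply: (@preimage_closed _ _ (fun a : 'rV[R]_(dim X) => `|a|) [set 1]);
    last exact: closed_eq.
  by move=> a _; exact: norm_continuous.
(* The sphere is empty only when every coordinate vector is 0; then [c = 1] serves. *)
have [[a0 Sa0]|S0] := pselect (S !=set0); last first.
  exists 1 => // a; have [->|an0] := eqVneq a 0; first by rewrite normr0 mulr0.
  case: S0; exists (`|a|^-1 *: a) => /=.
  by rewrite /S/= normrZ normfV normr_id mulVf// normr_eq0.
have [b /set_mem Sb bmin] :=
  compact_EVT_min (ex_intro _ _ Sa0) cS (continuous_subspaceT nc).
exists `|r2v b : X|.
  rewrite normr_gt0; apply/eqP => rb0.
  have b0 : b = 0 by apply: (can_inj r2vK); rewrite rb0 linear0.
  by move: Sb; rewrite /S/= b0 normr0 => /eqP; rewrite eq_sym oner_eq0.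
move=> a; have [->|an0] := eqVneq a 0; first by rewrite normr0 mulr0.
have ap : 0 < `|a| by rewrite normr_gt0.
have /bmin : `|a|^-1 *: a \in S.
  by apply/mem_set; rewrite /S/= normrZ normfV normr_id mulVf// normr_eq0.
by rewrite linearZ /= normrZ normfV normr_id ler_pdivlMl// mulrC.
Qed.

(** The ball is the continuous image under [r2v] of a closed set of coordinates, bounded by [r / c]
    with [c] from [norm_r2v_lower]. *)
Lemma compact_norm_ball (R : realType) (X : finDimNormedModType R) (r : R) :
  compact [set x : X | `|x| <= r].
Proof.
have [c c0 hc] := norm_r2v_lower X.
pose A := [set a : 'rV[R]_(dim X) | `|r2v a : X| <= r].
have -> : [set x : X | `|x| <= r] = [set (r2v a : X) | a in A].
  apply/seteqP; split=> x /=; last by move=> [a Aa <-].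
  by move=> xr; exists (v2r x); rewrite /A/= v2rK.
apply: continuous_compact; first exact/continuous_subspaceT/r2v_continuous.
apply: bounded_closed_compact.
  exists (r / c); split=> [|M rM a Aa]; first exact: num_real.
  apply: ltW; apply: le_lt_trans rM; rewrite ler_pdivlMr// mulrC.
  exact: le_trans (hc a) Aa.
apply: (@preimage_closed _ _ (fun a : 'rV[R]_(dim X) => `|r2v a : X|)
  [set y | y <= r]); last exact: closed_le.
by move=> a _; exact: continuous_norm_comp (@r2v_continuous R X) a.
Qed.

Lemma BJ_orthogonalZ (R : realType) (X : normedModType R) (c : R) (x y : X) :
  BJ_orthogonal x y -> BJ_orthogonal (c *: x) (c *: y).
Proof.
move=> xy l; rewrite scalerA mulrC -scalerA -scalerDr !normrZ.
by rewrite ler_wpM2l.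
Qed.

Lemma BJ_ratio_le3 (R : realType) (X : normedModType R) (x y : X) :
  x <> 0 -> BJ_orthogonal x y -> (`|x| + `|y|) / `|x + y| <= 3.
Proof.
move=> /eqP; rewrite -normr_gt0 => x0 /(_ 1); rewrite scale1r => xy.
rewrite ler_pdivrMr; last exact: lt_le_trans xy.
have := ler_normB (x + y) x; rewrite addrC addKr; lra.
Qed.

Definition BJ_unit_pairs (R : realType) (X : normedModType R) : set (X * X) :=
  [set p | [/\ `|p.1| = 1, `|p.2| <= 3 & BJ_orthogonal p.1 p.2]].

Lemma compact_BJ_unit_pairs (R : realType) (X : finDimNormedModType R) :
  compact (@BJ_unit_pairs R X).
Proof.
apply: (@subclosed_compact _ _
  ([set x : X | `|x| <= 1] `*` [set x : X | `|x| <= 3])).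
(* Orthogonality is closed, being an intersection over [l] of closed conditions, once [1] and [3]
   bound the two components. *)
- have -> : @BJ_unit_pairs R X =
    (fun p => `|p.1|) @^-1` [set 1] `&` (fun p => `|p.2|) @^-1` [set y | y <= 3]
     `&` \bigcap_(l in [set: R])
      ((fun p => `|p.1| - `|p.1 + l *: p.2|) @^-1` [set y | y <= 0]).
    apply/seteqP; split=> [p [p1 p2 o]|p [[p1 p2] o]].
      by do !split=> //; move=> l _; rewrite /= subr_le0; exact: o.
    by split=> // l; rewrite -subr_le0; exact: o.
  have fc : continuous (@fst X X) by move=> p; exact: cvg_fst.
  have sc : continuous (@snd X X) by move=> p; exact: cvg_snd.
  apply: closedI; first apply: closedI.
  + apply: preimage_closed; last exact: closed_eq.
    by move=> p _; apply: cvg_norm; exact: fc.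
  + apply: preimage_closed; last exact: closed_le.
    by move=> p _; apply: cvg_norm; exact: sc.
  + apply: closed_bigI => l _; apply: preimage_closed; last exact: closed_le.
    move=> p _; apply: cvgB; apply: cvg_norm; first exact: fc.
    by apply: cvgD; [exact: fc|apply: cvgZl_tmp; exact: sc].
- by apply: compact_setX; exact: compact_norm_ball.
- by move=> p [/= p1 p2 _]; split => //=; rewrite p1.
Qed.


(** From [2 * |x + y| < |x| + |y|] and [|y| <= |x + y| + |x|] follows [|y| < 3 * |x|], so dividing
    both vectors by [|x|] lands in the compact family. *)
Lemma large_ratio_BJ_unit_pair (R : realType) (X : normedModType R) (s : R)
    (x y : X) :
  2 <= s -> x <> 0 -> BJ_orthogonal x y -> s < (`|x| + `|y|) / `|x + y| ->
  exists2 p : X * X, BJ_unit_pairs p & s * `|p.1 + p.2| < 1 + `|p.2|.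
Proof.
move=> s2 /eqP xn0 xy; have x0 : 0 < `|x| by rewrite normr_gt0.
have := xy 1; rewrite scale1r => xxy.
rewrite ltr_pdivlMr; last exact: lt_le_trans xxy.
move=> sxy; exists (`|x|^-1 *: x, `|x|^-1 *: y) => /=.
  split=> /=; last exact: BJ_orthogonalZ.
    by rewrite normrZ normfV normr_id mulVf// gt_eqF.
  rewrite normrZ normfV normr_id ler_pdivrMl//.
  have := ler_normB (x + y) x; rewrite addrC addKr.
  have := ler_wpM2r (normr_ge0 (x + y)) s2; lra.
rewrite -scalerDr !normrZ !normfV !normr_id mulrCA.
by rewrite -(mulVf (lt0r_neq0 x0)) -mulrDr ltr_pM2l// invr_gt0.
Qed.

Lemma exists_BJ_ratio3 (R : realType) (X : finDimNormedModType R) :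
  rectangular_constant X = 3%:E ->
  exists x y : X,
    [/\ `|x| = 1, BJ_orthogonal x y, `|y| = 2 & `|x + y| = 1].
Proof.
move=> sup3.
have near3 (s : R) : 2 <= s -> s < 3 ->
    exists2 p : X * X, BJ_unit_pairs p & s * `|p.1 + p.2| < 1 + `|p.2|.
  move=> s2 s3.
  have : (s%:E < rectangular_constant X)%E by rewrite sup3 lte_fin.
  move=> /ereal_sup_gt[_ [x [y [x0 _ xy ->]]]]; rewrite lte_fin.
  exact: large_ratio_BJ_unit_pair.
(* On [BJ_unit_pairs] this is nonnegative and vanishes exactly where the ratio is 3; minimising it
   replaces maximising a quotient. *)
pose gap (p : X * X) := 3 * `|p.1 + p.2| - (1 + `|p.2|).
have gap_cont : continuous gap.
  move=> p; apply: cvgB; last first.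
    by apply: cvgD; [exact: cvg_cst|apply: cvg_norm; exact: cvg_snd].
  apply: cvgZl_tmp; apply: cvg_norm.
  by apply: cvgD; [exact: cvg_fst|exact: cvg_snd].
have [p1 Kp1 _] : exists2 p : X * X,
    BJ_unit_pairs p & 2 * `|p.1 + p.2| < 1 + `|p.2|.
  by apply: near3; lra.
have [p /set_mem Kp pmin] := compact_EVT_min (ex_intro _ _ Kp1)
  (@compact_BJ_unit_pairs R X) (continuous_subspaceT gap_cont).
have {Kp1} [px py pxy] := Kp.
have := pxy 1; rewrite scale1r px => N1.
have := ler_normB (p.1 + p.2) p.1; rewrite {1}addrC addKr px => p2N.
(* If [gap p <= 0], then [3 * |x + y| <= 1 + |y| <= 2 + |x + y|]; with [1 <= |x + y|] this forces
   [|x + y| = 1] and [|y| = 2]. *)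
have [gap_gt0|gap_le0] := ltP 0 (gap p); last first.
  by exists p.1, p.2; move: gap_le0; rewrite /gap; split=> //; lra.
(* The 4 bounds [|q.1 + q.2|] on the family, so [gap q < gap p / 4 * |q.1 + q.2| <= gap p], against
   minimality. The maximum with 2 meets the hypothesis of [near3]. *)
have [q Kq qlt] : exists2 q : X * X, BJ_unit_pairs q &
    Num.max 2 (3 - gap p / 4) * `|q.1 + q.2| < 1 + `|q.2|.
  by apply: near3; [rewrite le_max lexx|rewrite gt_max; lra].
have := pmin _ (mem_set Kq); rewrite {2}/gap.
have [qx qy _] := Kq.
have := ler_normD q.1 q.2; rewrite qx => qN.
have max_ge : 3 - gap p / 4 <= Num.max 2 (3 - gap p / 4).
  by rewrite le_max lexx orbT.
have := ler_wpM2r (normr_ge0 (q.1 + q.2)) max_ge.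
have : gap p * `|q.1 + q.2| <= gap p * 4 by rewrite ler_pM2l//; lra.
lra.
Qed.

(* Beyond an endpoint, a smaller norm would contradict convexity at that
   endpoint, which lies between the point and the other endpoint. *)
Lemma unit_segment_BJ (R : realType) (X : normedModType R) (u v : X) :
  `|u| = 1 -> `|v| = 1 ->
  (forall t : R, 0 < t < 1 -> `|t *: u + (1 - t) *: v| = 1) ->
  BJ_orthogonal u (v - u).
Proof.
move=> u1 v1 uv l; rewrite u1.
have [l0|l0] := ltP l 0.
  have : `|(1 - l) *: u| <= `|u + l *: (v - u)| + `|l *: v|.
    have -> : (1 - l) *: u = u + l *: (v - u) - l *: v.
      by rewrite scalerBr scalerBl scale1r -addrA addrAC subrr add0r.
    exact: ler_normB.
  by rewrite !normrZ u1 v1 (ltr0_norm l0) gtr0_norm; lra.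
have [l1|l1] := ltP 1 l.
  have : `|l *: v| <= `|u + l *: (v - u)| + `|(l - 1) *: u|.
    have -> : l *: v = u + l *: (v - u) + (l - 1) *: u.
      by rewrite scalerBr scalerBl scale1r -addrA subrKA addrC subrK.
    exact: ler_normD.
  by rewrite !normrZ u1 v1 !gtr0_norm; lra.
have -> : u + l *: (v - u) = (1 - l) *: u + (1 - (1 - l)) *: v.
  by rewrite subKr scalerBr scalerBl scale1r addrCA addrC.
(* The hypothesis covers only the open segment, so the endpoints are treated apart. *)
have [->|ln0] := eqVneq l 0.
  by rewrite subr0 subrr scale1r scale0r addr0 u1.
have [->|ln1] := eqVneq l 1.
  by rewrite subrr subr0 scale1r scale0r add0r v1.
rewrite uv//; apply/andP; split; last by rewrite gtrBl lt0r ln0.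
by rewrite subr_gt0 lt_neqAle ln1.
Qed.

Theorem corollary3p5 (R : realType) (X : finDimNormedModType R)
    (dim_ge2 : (2 <= \dim {:X})%N) :
  rectangular_constant X = 3%:E <->
  exists u v : X,
    [/\ unit_sphere u, unit_sphere v,
        forall t : R, 0 < t < 1 -> `|t *: u + (1 - t) *: v| = 1
      & `|u - v| = 2].
Proof.
split=> [/exists_BJ_ratio3[x [y [x1 xy y2 xy1]]]|[u [v [u1 v1 uv uv2]]]].
  exists x, (x + y); split=> //; last by rewrite opprD addrA subrr add0r normrN.
  (* Orthogonality at [1 - t] gives norm at least 1 on the segment; convexity of the norm gives at
     most 1. *)
  move=> t /andP[t0 t1]; have := xy (1 - t); rewrite x1 => ge1.
  have E : t *: x + (1 - t) *: (x + y) = x + (1 - t) *: y.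
    by rewrite scalerDr addrA -scalerDl subrKC scale1r.
  apply/eqP; rewrite eq_le {2}E ge1 andbT.
  apply: le_trans (ler_normD _ _) _.
  by rewrite !normrZ x1 xy1 !mulr1 !gtr0_norm; lra.
have vu2 : `|v - u| = 2 by rewrite distrC.
apply/eqP; rewrite eq_le; apply/andP; split.
  apply: ge_ereal_sup => _ [x [y [x0 _ xy ->]]].
  by rewrite lee_fin; exact: BJ_ratio_le3.
apply: ereal_sup_ubound; exists u, (v - u); split.
- move=> u0; move: u1; rewrite /unit_sphere /= u0 normr0 => /eqP.
  by rewrite eq_sym oner_eq0.
- by move=> e; move: vu2; rewrite e normr0; lra.
- exact: unit_segment_BJ.
- by rewrite subrKC vu2 u1 v1 divr1; congr EFin; lra.
Qed.
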